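(* Let $q$ be a prime power, $i\ge 1$ an integer, and let $L(x) = \sum_{s=0}^{i-1} \alpha_s x^{q^s} \in F_{q^i}[x]$ be a nonzero polynomial. Denote by $q^l$ the degree of $L(x)$, and by $r$ the rank of the $i \times i$ matrix \[ A(L) = \left(\begin{array}{ccccc} \alpha_0 & \alpha_{i-1}^q & \alpha_{i-2}^{q^2} & \ldots & \alpha_1^{q^{i-1}}\\ \alpha_1 & \alpha_0^q & \alpha_{i-1}^{q^2} & \ldots & \alpha_2^{q^{i-1}}\\ \alpha_2 & \alpha_1^q & \alpha_0^{q^2} & \ldots & \alpha_3^{q^{i-1}}\\ \vdots & \vdots & \vdots & \vdots & \vdots \\ \alpha_{i-1} & \alpha_{i-2}^q & \alpha_{i-3}^{q^2} & \ldots & \alpha_0^{q^{i-1}} \end{array}\right), \] so that $1 \leq r \leq i$. Let $d$ be an integer with $0 < d < q^{i-l}$. Then \[ M_{q^{i-r}}(q^i, q^i - dq^l) \geq \sum_{j=1}^{d} \frac{N_j(q^i)}{q^{i-r}}, \] where $N_j(q^i)$ denotes the number of permutation polynomials over $F_{q^i}$ of degree $j$.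
   Context: $F_{q^i}$ is the finite field with $q^i$ elements. A permutation polynomial over $F_{q^i}$ is a polynomial in $F_{q^i}[x]$ whose induced map $F_{q^i}\to F_{q^i}$ is a bijection; $N_j(q^i)$ counts those of degree exactly $j$. A $\lambda$-permutation of length $n$ (where $\lambda$ divides $n$) is an arrangement (sequence of length $n$) of the multiset consisting of $n/\lambda$ distinct symbols, each repeated exactly $\lambda$ times. The distance between two $\lambda$-permutations is the Hamming distance, i.e. the number of positions in which they disagree. A frequency permutation array $FPA_\lambda(n,d)$ is a set $T$ of $\lambda$-permutations of length $n$ (on a common set of $n/\lambda$ symbols) such that any two distinct members of $T$ have distance at least $d$; its size is $|T|$. $M_\lambda(n,d)$ denotes the maximum size of an $FPA_\lambda(n,d)$. The $(k,j)$ entry of $A(L)$ (rows and columns indexed by $0,\dots,i-1$) is $\alpha_{(k-j) \bmod i}^{q^j}$. *)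

(* Defs.v *)
From mathcomp Require Import all_boot all_order all_algebra.

Set Implicit Arguments.
Unset Strict Implicit.
Unset Printing Implicit Defensive.

Import GRing.Theory.
Local Open Scope ring_scope.

Definition prime_power (q : nat) : Prop :=
  exists p m : nat, [/\ prime p, (0 < m)%N & q = (p ^ m)%N].

Definition perm_poly (F : finFieldType) (f : {poly F}) : bool :=
  injectiveb (horner f) && [forall y, y \in codom (horner f)].

Lemma perm_polyP (F : finFieldType) (f : {poly F}) :
  reflect (bijective (horner f)) (perm_poly f).
Proof.
apply: (iffP andP) => [[/injectiveP fI _]|[g fK gK]]; first exact: injF_bij.
split; first by apply/injectiveP; exact: can_inj fK.
by apply/forallP => y; apply/codomP; exists (g y); rewrite gK.
Qed.

(* {poly_(j.+1) F} is the finite type of all polynomials of degree at most j,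
   so nothing of degree exactly j is missed. *)
Definition nb_perm_poly (F : finFieldType) (j : nat) : nat :=
  #|[set f : {poly_(j.+1) F} |
      (size (f : {poly F}) == j.+1) && perm_poly (f : {poly F})]|.

Definition linearized_poly (F : nzRingType) (q i : nat) (alpha : 'I_i -> F) :
  {poly F} := \sum_(s < i) alpha s *: 'X^(q ^ s).

Lemma ord_pos (i : nat) (k : 'I_i) : (0 < i)%N.
Proof. exact: leq_ltn_trans (ltn_ord k). Qed.

(* (k - j) mod i; i is added first because subtraction on nat truncates. *)
Definition ord_modsub (i : nat) (k j : 'I_i) : 'I_i :=
  Ordinal (ltn_pmod (k + (i - j)) (ord_pos k)).

Definition linearized_mx (F : nzRingType) (q i : nat) (alpha : 'I_i -> F) :
  'M[F]_i := \matrix_(k, j) alpha (ord_modsub k j) ^+ (q ^ j).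

(* Words of length n over n / lambda symbols in which each symbol occurs
   exactly lambda times; there are none unless lambda divides n. *)
Definition lambda_perm (lambda n : nat) (w : {ffun 'I_n -> 'I_(n %/ lambda)}) :
  bool := (lambda %| n)%N && [forall s, #|[set x | w x == s]| == lambda].

Definition hamming (n : nat) (S : eqType) (v w : {ffun 'I_n -> S}) : nat :=
  #|[set x | v x != w x]|.

Definition is_FPA (lambda n d : nat)
    (T : {set {ffun 'I_n -> 'I_(n %/ lambda)}}) : bool :=
  [forall v in T, lambda_perm v] &&
  [forall v in T, forall w in T, (v != w) ==> (d <= hamming v w)%N].

Definition max_FPA (lambda n d : nat) : nat :=
  \max_(T : {set {ffun 'I_n -> 'I_(n %/ lambda)}} | is_FPA d T) #|T|.

(* Main.v *)
(* Send x to phi(x) = (x, x^q, ..., x^(q^(i-1))). Then phi(x) *m A(L) = phi(L(x)),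
   so phi maps the image of L into the row space of A(L), and the kernel of L
   into the left kernel. A subspace of dimension t contains at most q^t vectors
   phi(x): expressed in a basis taken among these vectors, the coordinates are
   fixed by c |-> c^q, hence take at most q values. Since |ker L| |im L| = q^i,
   both bounds are equalities: |im L| = q^r and |ker L| = q^(i-r).
   The words are the value tables of L o f, for f a permutation polynomial of
   degree at most d. Two of them agree exactly at the roots of L o (f - g), a
   polynomial of degree at most d q^l < q^i; they coincide only if f - g is a
   constant in ker L, so each word comes from at most q^(i-r) polynomials. *)

Require Import Defs.
From mathcomp Require Import all_boot all_order all_algebra.
From mathcomp Require Import finfield.

Import Order.TTheory GRing.Theory Num.Theory.
Local Open Scope ring_scope.

(** * Root counts and the [q]-power map *)

Lemma card_roots_lt (F : finFieldType) (p : {poly F}) (A : {set F}) :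
  p != 0 -> {in A, forall x, root p x} -> (#|A| < size p)%N.
Proof.
move=> p0 pA; rewrite cardE; apply: (max_poly_roots p0); last exact: enum_uniq.
by apply/allP => x; rewrite mem_enum => /pA.
Qed.

Lemma card_fixed_expr_le (F : finFieldType) (q : nat) :
  (1 < q)%N -> (#|[set b : F | b ^+ q == b]| <= q)%N.
Proof.
move=> q1; have sz : size ('X^q - 'X : {poly F}) = q.+1.
  by rewrite size_polyDl size_polyXn ?size_polyN ?size_polyX ?ltnS.
rewrite -ltnS -sz; apply: card_roots_lt; first by rewrite -size_poly_gt0 sz.
by move=> x; rewrite inE /root !hornerE subr_eq0.
Qed.

Lemma sumrX_pchar (F : fieldType) (q : nat) (I : finType) (f : I -> F) :
  [pchar F].-nat q -> (\sum_x f x) ^+ q = \sum_x f x ^+ q.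
Proof.
move=> qF; apply: (big_morph (fun x => x ^+ q)).
  by move=> x y; rewrite exprDn_pchar.
by rewrite expr0n; case: q qF.
Qed.

(** * Vectors of conjugates in a subspace *)

(** The map [phi] of the overview. *)
Definition conjugates (F : fieldType) (q i : nat) (x : F) : 'rV[F]_i :=
  \row_k x ^+ (q ^ k).

Lemma conjugates_inj (F : fieldType) (q i : nat) :
  (0 < i)%N -> injective (@conjugates F q i).
Proof.
by move=> i0 x y /rowP/(_ (Ordinal i0)); rewrite !mxE /= expn0 !expr1.
Qed.

(* The cyclic shift composed with the q-power map fixes every conjugates q i x. *)
Lemma frobenius_conjugates_coef (F : finFieldType) (q i t : nat)
    (B : 'M[F]_(t, i)) (y : 'I_t -> F) (x : F) (b : 'rV_t) :
  [pchar F].-nat q -> #|F| = (q ^ i)%N -> row_free B ->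
  (forall j, row j B = conjugates F q i (y j)) ->
  conjugates F q i x = b *m B -> forall j, b 0 j ^+ q = b 0 j.
Proof.
move=> qF cF Bfree By xE.
have BE j k : B j k = y j ^+ (q ^ k).
  by have /rowP/(_ k) := By j; rewrite !mxE.
have xk k : x ^+ (q ^ k) = \sum_j b 0 j * y j ^+ (q ^ k) ->
    x ^+ (q ^ k.+1) = \sum_j b 0 j ^+ q * y j ^+ (q ^ k.+1).
  move=> e; rewrite expnSr exprM e sumrX_pchar //.
  by apply: eq_bigr => j _; rewrite exprMn -exprM.
have xo (k : 'I_i) : x ^+ (q ^ k) = \sum_j b 0 j * y j ^+ (q ^ k).
  have /rowP/(_ k) := xE; rewrite !mxE => ->.
  by apply: eq_bigr => j _; rewrite BE.
(* The rows of [B] are independent, so it suffices that the [q]-th powers of the coordinates yield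
   the same vector. *)
suff bE : map_mx (fun c => c ^+ q) b = b by move=> j; rewrite -{2}bE mxE.
apply: (row_free_inj Bfree); rewrite -xE; apply/rowP=> -[[|k] ki].
  (* Entry 0 is obtained from the last entry: its [q]-th power is [x ^+ (q ^ i) = x]. *)
  have /xk : x ^+ (q ^ i.-1) = \sum_j b 0 j * y j ^+ (q ^ i.-1).
    have i1 : (i.-1 < i)%N by rewrite prednK.
    exact: (xo (Ordinal i1)).
  rewrite prednK // -cF expf_card => xE0.
  rewrite !mxE /= expn0 expr1 xE0; apply: eq_bigr => j _.
  by rewrite !mxE BE expf_card /= expn0 expr1.
have /xk xS := xo (Ordinal (ltnW ki)).
rewrite !mxE /= xS; apply: eq_bigr => j _.
by rewrite !mxE BE.
Qed.

Lemma card_conjugates_submx (F : finFieldType) (q i m : nat) (U : 'M[F]_(m, i)) :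
  (1 < q)%N -> [pchar F].-nat q -> (0 < i)%N -> #|F| = (q ^ i)%N ->
  (#|[set x | (conjugates F q i x <= U)%MS]| <= q ^ \rank U)%N.
Proof.
move=> q1 qF i0 cF; set G := [set x | _].
(* The rows of [M] are all the conjugate vectors lying in [U]; [B] selects a basis of their span
   among them. *)
pose M := \matrix_(k < #|G|) conjugates F q i (enum_val k).
pose B := rowsub (maxrankfun M) M.
have MU : (\rank M <= \rank U)%N.
  apply/mxrankS/row_subP => k; rewrite rowK.
  by have := enum_valP k; rewrite inE.
pose b x := conjugates F q i x *m pinvmx B.
have bB x : x \in G -> conjugates F q i x = b x *m B.
  move=> xG; rewrite mulmxKpV // eq_maxrowsub.
  have <- : row (enum_rank_in xG x) M = conjugates F q i x.
    by rewrite rowK enum_rankK_in.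
  exact: row_sub.
apply: (@leq_trans (q ^ \rank M)); last by rewrite leq_pexp2l // ltnW.
pose K := [set c : F | c ^+ q == c].
apply: (@leq_trans (#|K| ^ \rank M)); last first.
  have [-> | rM] := posnP (\rank M); first by rewrite !expn0.
  by rewrite leq_exp2r // card_fixed_expr_le.
pose h x := [ffun j => b x 0 j].
have bK x : x \in G -> forall j, b x 0 j ^+ q = b x 0 j.
  move=> /bB; apply: (@frobenius_conjugates_coef F q i _ B
    (fun j => enum_val (maxrankfun M j))) => //; first exact: maxrowsub_free.
  by move=> j; rewrite row_rowsub rowK.
have h_inj : {in G &, injective h}.
  move=> x y xG yG /ffunP hxy; apply: (conjugates_inj F q _ i0).
  rewrite (bB _ xG) (bB _ yG); congr (_ *m _); apply/rowP => j.
  by have := hxy j; rewrite !ffunE.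
rewrite -[leqLHS](card_in_imset h_inj).
have -> : (#|K| ^ \rank M)%N =
    #|[pred c : {ffun 'I_(\rank M) -> F} | c \in ffun_on (mem K)]|.
  by rewrite card_ffun_on card_ord.
apply/subset_leq_card/subsetP => _ /imsetP[x xG ->].
by apply/ffun_onP => j; rewrite ffunE inE bK.
Qed.

(** * Image and kernel of a linearized polynomial *)

Lemma horner_linearized (F : nzRingType) (q i : nat) (alpha : 'I_i -> F) (x : F) :
  (linearized_poly q alpha).[x] = \sum_(s < i) alpha s * x ^+ (q ^ s).
Proof. by rewrite horner_sum; apply: eq_bigr => s _; rewrite hornerZ hornerXn. Qed.

Lemma linearizedB (F : fieldType) (q i : nat) (alpha : 'I_i -> F) (x y : F) :
  [pchar F].-nat q ->
  (linearized_poly q alpha).[x - y] =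
    (linearized_poly q alpha).[x] - (linearized_poly q alpha).[y].
Proof.
move=> qF; rewrite !horner_linearized -sumrB; apply: eq_bigr => s _.
have qsF : [pchar F].-nat (q ^ s)%N by rewrite pnatX qF.
by rewrite -mulrBr -[x in RHS](subrK y) [in RHS]exprDn_pchar // addrK.
Qed.

(** Raising [L(x)] to the power [q ^ j] turns the term of index [s] into
    [alpha s ^+ (q ^ j) * x ^+ (q ^ (s + j))]. As [x ^+ (q ^ i) = x], the exponent [s + j] may be
    reduced modulo [i], which gives the sum along column [j]. *)
Lemma conjugates_linearized (F : finFieldType) (q i : nat) (alpha : 'I_i -> F)
    (x : F) :
  [pchar F].-nat q -> #|F| = (q ^ i)%N ->
  conjugates F q i x *m linearized_mx q alpha =
    conjugates F q i (linearized_poly q alpha).[x].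
Proof.
move=> qF cF; apply/rowP => j; rewrite !mxE horner_linearized.
have expr_modi k : x ^+ (q ^ (k %% i)) = x ^+ (q ^ k).
  rewrite [in RHS](divn_eq k i); elim: (k %/ i)%N => [|n IHn].
    by rewrite mul0n add0n.
  by rewrite IHn mulSn -addnA [in RHS]expnD exprM -cF expf_card.
have i0 := ord_pos j.
pose h (s : 'I_i) := Ordinal (ltn_pmod (s + j) i0).
have hK s : ord_modsub (h s) j = s.
  apply/val_inj; rewrite /= modnDml -addnA subnKC ?(ltnW (ltn_ord j)) //.
  by rewrite modnDr modn_small.
have h_inj : injective h := can_inj (g := fun k => ord_modsub k j) hK.
rewrite (reindex h) /=; last by apply: onW_bij; exact: injF_bij.
rewrite sumrX_pchar ?pnatX ?qF //; apply: eq_bigr => s _.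
by rewrite !mxE hK /= expr_modi exprMn -exprM -expnD mulrC.
Qed.

(** Translation by a preimage of [a] carries the kernel onto the fiber over [a]. *)
Lemma card_fibers (F : finZmodType) (g : F -> F) :
  {morph g : x y / x - y} ->
  {in [set g x | x in F], forall a, #|[set x | g x == a]| = #|[set x | g x == 0]|}.
Proof.
move=> gB _ /imsetP[y _ ->]; rewrite -[RHS](card_imset _ (addIr y)).
apply: eq_card => x; rewrite !inE; apply/idP/imsetP => [/eqP gx | [z]].
  by exists (x - y); rewrite ?subrK // inE gB gx subrr.
by rewrite inE => /eqP gz ->; rewrite -subr_eq0 -gB addrK gz.
Qed.

Lemma card_image_kernel (F : finZmodType) (g : F -> F) :
  {morph g : x y / x - y} ->
  (#|[set g x | x in F]| * #|[set x | g x == 0%R]|)%N = #|F|.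
Proof.
move=> gB; rewrite -[RHS]sum1_card (partition_big_imset g) /= -sum_nat_const.
apply: eq_bigr => a ag; rewrite -(card_fibers F g gB a ag) -sum1dep_card.
by apply: eq_bigl => x.
Qed.

Lemma card_linearized (F : finFieldType) (q i : nat) (alpha : 'I_i -> F) :
  (1 < q)%N -> [pchar F].-nat q -> (0 < i)%N -> #|F| = (q ^ i)%N ->
  let L := linearized_poly q alpha in
  let r := \rank (linearized_mx q alpha) in
  #|[set L.[x] | x in F]| = (q ^ r)%N /\
  #|[set x | L.[x] == 0]| = (q ^ (i - r))%N.
Proof.
move=> q1 qF i0 cF L r.
have gB : {morph horner L : x y / x - y} by move=> x y; exact: linearizedB.
have prod := card_image_kernel F _ gB; rewrite cF in prod.
have ri : (r <= i)%N by exact: rank_leq_row.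
have im : (#|[set L.[x] | x in F]| <= q ^ r)%N.
  apply: leq_trans (card_conjugates_submx _ _ _ _ _ q1 qF i0 cF).
  apply/subset_leq_card/subsetP => _ /imsetP[x _ ->].
  by rewrite inE -conjugates_linearized // submxMl.
have ke : (#|[set x | L.[x] == 0%R]| <= q ^ (i - r))%N.
  rewrite -mxrank_ker.
  apply: leq_trans (card_conjugates_submx _ _ _ _ _ q1 qF i0 cF).
  apply/subset_leq_card/subsetP => x; rewrite !inE => /eqP Lx.
  apply/sub_kermxP; rewrite conjugates_linearized // -/L Lx.
  by apply/rowP => k; rewrite !mxE expr0n eqn0Ngt expn_gt0 ltnW.
have prod' : (q ^ r * q ^ (i - r))%N = (q ^ i)%N by rewrite -expnD subnKC.
have qr0 k : (0 < q ^ k)%N by rewrite expn_gt0 ltnW.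
split; apply/eqP; rewrite eqn_leq ?im ?ke /=.
  rewrite -(leq_pmul2r (qr0 (i - r)%N)) prod' -prod.
  by rewrite leq_mul2l ke orbT.
rewrite -(leq_pmul2l (qr0 r)) prod' -prod.
by rewrite leq_mul2r im orbT.
Qed.

(** * From permutation polynomials to words *)

(** The degree of [L \Po h] is at most [d * m], so that many roots force it to vanish; then [h]
    cannot have positive degree. *)
Lemma comp_many_roots (F : finFieldType) (L h : {poly F}) (d m : nat) :
  size L = m.+1 -> (0 < m)%N -> (size h <= d.+1)%N ->
  (d * m < #|[set x | L.[h.[x]] == 0%R]|)%N ->
  exists2 c, h = c%:P & L.[c] = 0.
Proof.
move=> sL m0 sh roots.
have szE := size_comp_poly L h; rewrite sL /= in szE.
have L0 : L \Po h = 0.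
  apply/eqP/negPn/negP => Lh0.
  have : (#|[set x | L.[h.[x]] == 0%R]| < size (L \Po h))%N.
    by apply: card_roots_lt => // x; rewrite inE rootE horner_comp.
  rewrite -(prednK (n := size _)) ?size_poly_gt0 // szE ltnS leqNgt => /negP; apply.
  apply: leq_ltn_trans roots.
  by rewrite mulnC leq_mul2r -subn1 leq_subLR add1n sh orbT.
have /size1_polyC hE : (size h <= 1)%N.
  (* The degree formula also covers the zero polynomial, since [0.-1 = 0]: it reads
     [m * (size h).-1 = 0]. *)
  move: szE; rewrite L0 size_poly0 => /esym/eqP; rewrite muln_eq0 eqn0Ngt m0 /=.
  by case: (size h) => [|[]].
exists h`_0 => //; apply/eqP; move/eqP: L0.
by rewrite {1}hE comp_polyCr polyC_eq0.
Qed.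

(** Serves to name the values of [L] by symbols; as [s] is total, a default symbol must exist
    outside [A]. *)
Lemma ex_label (F : finType) (A : {set F}) (k : nat) :
  #|A| = k -> (0 < k)%N -> exists s : F -> 'I_k, {in A &, injective s}.
Proof.
move=> <- /card_gt0P[a aA]; exists (enum_rank_in aA).
exact: can_in_inj (enum_rankK_in aA).
Qed.

Lemma lambda_perm_label (F : finType) (lambda n : nat) (e : 'I_n -> F)
    (g : F -> F) (s : F -> 'I_(n %/ lambda)) :
  (lambda %| n)%N -> bijective e -> #|[set g y | y in F]| = (n %/ lambda)%N ->
  {in [set g y | y in F] &, injective s} ->
  {in [set g y | y in F], forall a, #|[set y | g y == a]| = lambda} ->
  lambda_perm [ffun x => s (g (e x))].
Proof.
move=> ln e_bij cI s_inj fib; rewrite /lambda_perm ln; apply/forallP => b.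
(* By cardinality every symbol labels exactly one value of [g], so its positions correspond under
   [e] to one fiber. *)
have sT : s @: [set g y | y in F] = setT.
  by apply/eqP; rewrite eqEcard subsetT cardsT card_ord card_in_imset // cI leqnn.
have /imsetP[a aI ->] : b \in s @: [set g y | y in F] by rewrite sT inE.
rewrite -[eqbRHS](fib a aI) -(on_card_preimset (onW_bij _ e_bij)).
apply/eqP/eq_card => x; rewrite !inE ffunE.
apply/eqP/eqP => [/s_inj -> //|-> //]; exact: imset_f.
Qed.

(** Double counting: a polynomial has only one degree, so it contributes to at most one summand. *)
Lemma sum_nb_perm_poly_le (F : finFieldType) (d : nat) :
  (\sum_(1 <= j < d.+1) nb_perm_poly F j <=
    #|[set f : {poly_(d.+1) F} | perm_poly (f : {poly F})]|)%N.
Proof.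
set P := [set f | _].
pose fiber f j : nat := if size (f : {poly F}) == j.+1 then 1 else 0.
apply: (@leq_trans (\sum_(1 <= j < d.+1) \sum_(f in P) fiber f j)%N).
  rewrite big_nat [leqRHS]big_nat; apply: leq_sum => j /andP[_ jd].
  have wK (f : {poly_(j.+1) F}) : npolyp d.+1 (f : {poly F}) = f :> {poly F}.
    by rewrite npolypK // (leq_trans (size_npoly f)).
  pose w (f : {poly_(j.+1) F}) := npolyp d.+1 (f : {poly F}).
  have w_inj : injective w.
    by move=> f g fg; apply/val_inj; rewrite /= -wK -/(w f) fg wK.
  rewrite /nb_perm_poly -(card_imset _ w_inj) -big_mkcondr sum1dep_card.
  apply/subset_leq_card/subsetP => _ /imsetP[f + ->]; rewrite !inE => /andP[sf pf].
  by rewrite wK pf.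
rewrite exchange_big -sum1_card; apply: leq_sum => f _ /=.
apply: (@leq_trans (\sum_(1 <= j < d.+1 | j == (size (f : {poly F})).-1) 1)%N).
  rewrite [leqRHS]big_mkcond /=; apply: leq_sum => j _.
  by rewrite /fiber; case: (_ =P j.+1) => [->|//]; rewrite eqxx.
by rewrite big_nat1_eq; case: ifP.
Qed.

Theorem theorem3p3 (q i : nat) (hq : prime_power q) (hi : (1 <= i)%N)
    (F : finFieldType) (hF : #|F| = (q ^ i)%N)
    (alpha : 'I_i -> F) (hL : linearized_poly q alpha != 0)
    (l : nat) (hl : size (linearized_poly q alpha) = (q ^ l).+1)
    (r : nat) (hr : r = \rank (linearized_mx q alpha)) :
  (1 <= r <= i)%N /\
  forall d : nat, (0 < d < q ^ (i - l))%N ->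
    \sum_(1 <= j < d.+1) (nb_perm_poly F j)%:R / (q ^ (i - r))%:R
      <= (max_FPA (q ^ (i - r)) (q ^ i) (q ^ i - d * q ^ l))%:R :> rat.
Proof.
have [p [m [p_pr m0 qE]]] := hq.
have q1 : (1 < q)%N by rewrite qE -(exp1n m) ltn_exp2r // prime_gt1.
have qF : [pchar F].-nat q.
  have pF : p \in [pchar F].
    by apply: (@card_finPcharP _ _ (m * i)) => //; rewrite hF qE expnM.
  by rewrite qE pnatX pnatE ?pF.
have ri : (r <= i)%N by rewrite hr rank_leq_row.
have q0 k : (0 < q ^ k)%N by rewrite expn_gt0 ltnW.
have [cI cK] := card_linearized F q i alpha q1 qF hi hF.
set L := linearized_poly q alpha in hL hl cI cK.
rewrite -hr in cI cK.
split.
  (* Column 0 of the matrix lists the coefficients of [L], so a zero matrix would give [L = 0]. *)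
  rewrite ri andbT hr lt0n mxrank_eq0; apply: contra hL => /eqP A0.
  apply/eqP/big1 => s _; have /matrixP/(_ s (Ordinal hi)) := A0.
  rewrite !mxE /= expn0 expr1; set t := ord_modsub _ _; have -> : t = s.
    by apply/val_inj; rewrite /= subn0 modnDr modn_small.
  by move=> ->; rewrite scale0r.
move=> d /andP[d0 dlt].
have li : (l < i)%N.
  (* For [i <= l] the truncated difference is 0 and [d < q ^ 0] contradicts [0 < d]. *)
  by rewrite -subn_gt0 lt0n; apply: contraTneq dlt => ->; rewrite -leqNgt.
have dl : (d * q ^ l < q ^ i)%N.
  by rewrite -(subnK (ltnW li)) expnD ltn_mul2r q0.
rewrite -mulr_suml ler_pdivrMr ?ltr0n // -natr_sum -natrM ler_nat.
apply: leq_trans (sum_nb_perm_poly_le F d) _; set P := [set f | _].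
set lambda := (q ^ (i - r))%N; set n := (q ^ i)%N.
have lam_n : (lambda %| n)%N by rewrite dvdn_exp2l // leq_subr.
have nlam : (n %/ lambda)%N = (q ^ r)%N.
  by rewrite -expnB ?leq_subr ?subKn // ltnW.
have gB : {morph horner L : x y / x - y} by move=> x y; exact: linearizedB.
have [s s_inj] : exists s : F -> 'I_(n %/ lambda),
    {in [set L.[x] | x in F] &, injective s}.
  by apply: ex_label; rewrite ?nlam.
(* Positions of a word are identified with the field elements. *)
pose e (x : 'I_n) : F := enum_val (cast_ord (esym hF) x).
have e_bij : bijective e.
  by apply: inj_card_bij; rewrite ?card_ord ?hF // => x y /enum_val_inj/cast_ord_inj.
pose W (f : {poly_(d.+1) F}) : {ffun 'I_n -> 'I_(n %/ lambda)} :=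
  [ffun x => s L.[(f : {poly F}).[e x]]].
have agree f g : #|[set x | W f x == W g x]| =
    #|[set x | L.[((f : {poly F}) - (g : {poly F})).[x]] == 0%R]|.
  rewrite -(on_card_preimset (onW_bij _ e_bij)); apply: eq_card => x.
  rewrite !inE !ffunE hornerD hornerN gB subr_eq0.
  by apply/eqP/eqP => [/s_inj -> //|-> //]; exact: imset_f.
have sizeB (f g : {poly_(d.+1) F}) :
    (size ((f : {poly F}) - (g : {poly F}))%R <= d.+1)%N.
  by rewrite (leq_trans (size_polyD _ _)) // size_polyN geq_max !size_npoly.
have close f g : (d * q ^ l < #|[set x | W f x == W g x]|)%N ->
    exists2 c, (f : {poly F}) - (g : {poly F}) = c%:P & L.[c] = 0.
  by rewrite agree; apply: comp_many_roots.
apply: (@leq_trans (#|W @: P| * lambda)).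
  rewrite -[leqLHS]sum1_card (partition_big_imset W) /= -sum_nat_const.
  apply: leq_sum => _ /imsetP[g gP ->].
  (* Every polynomial with the same word as [g] is [g] plus a constant of the kernel of [L], which
     has [lambda] elements. *)
  pose shift c := npolyp d.+1 ((g : {poly F}) + c%:P).
  rewrite -[leqRHS]cK; apply: leq_trans (leq_imset_card shift _).
  rewrite sum1dep_card; apply/subset_leq_card/subsetP => f; rewrite inE.
  move=> /andP[_ /eqP fg]; have [c fgc Lc] : exists2 c,
      (f : {poly F}) - (g : {poly F}) = c%:P & L.[c] = 0.
    apply: close; rewrite fg; apply: leq_trans dl _.
    by rewrite -[leqLHS]card_ord; apply/subset_leq_card/subsetP => x _; rewrite inE.
  apply/imsetP; exists c; first by rewrite inE Lc.
  apply/val_inj; rewrite /= npolypK -fgc addrC subrK //; exact: size_npoly.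
(* It remains to see that the set of words is a frequency permutation array. *)
rewrite leq_mul2r; apply/orP; right.
apply: leq_bigmax_cond; apply/andP; split; apply/forall_inP.
  move=> _ /imsetP[f + ->]; rewrite inE => /perm_polyP f_bij.
  have := lambda_perm_label F lambda n (horner (f : {poly F}) \o e) (horner L).
  apply=> //; first exact: bij_comp.
    by rewrite cI.
  by move=> a aI; rewrite card_fibers.
move=> _ /imsetP[f fP ->]; apply/forall_inP => _ /imsetP[g gP ->].
apply/implyP => fg; rewrite leq_subLR.
(* Distance and number of agreements add up to [n]; more than [d * q ^ l] agreements would make the
   two words equal. *)
have nE : n = (#|[set x | W f x == W g x]| + hamming (W f) (W g))%N.
  rewrite /hamming -[LHS]card_ord -(cardsC [set x | W f x == W g x]).
  by congr (_ + _)%N; apply: eq_card => x; rewrite !inE.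
rewrite [leqLHS]nE leq_add2r leqNgt; apply: contra fg => /close[c fgc Lc].
apply/eqP/ffunP => x; rewrite !ffunE; congr (s _).
by apply/eqP; rewrite -subr_eq0 -gB -hornerN -hornerD fgc hornerC Lc.
Qed.
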